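(* Let $\mathbb F_d$ be the free group on $d$ generators. The group $\mathrm{Pol}_2(\mathbb F_d)$ is isomorphic to the semidirect product $(\mathbb Z[\mathbb F_d]^{\oplus d^2})\rtimes\mathbb F_d$, where $\mathbb F_d$ acts on $\mathbb Z[\mathbb F_d]$ by left multiplication. Moreover, the abelianization of $\mathrm{Pol}_2(\mathbb F_d)$ is isomorphic to $\mathbb Z^{d^2+d}$.
   Context: For groups $G,H$ and $\varphi\colon G\to H$, put $(\Delta_k\varphi)(g):=\varphi(kg)\varphi(g)^{-1}$. A map is polynomial of degree $-1$ if it is constantly $1$, and polynomial of degree $m+1$ ($m\ge-1$) if $\Delta_k\varphi$ is polynomial of degree $m$ for all $k\in G$; quadratic means polynomial of degree $2$; unital means $\varphi(1)=1$. $\mathrm{Pol}_2(G)$ is the group with a universal unital quadratic map $\varphi\colon G\to\mathrm{Pol}_2(G)$: every unital quadratic map $G\to H$ to a group $H$ factors through $\varphi$ via a unique homomorphism $\mathrm{Pol}_2(G)\to H$. *)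

(* Defs.v *)
From HB Require Import structures.
From mathcomp Require Import all_boot all_order all_algebra.
From mathcomp Require Import finmap monalg boolp.

Set Implicit Arguments.
Unset Strict Implicit.
Unset Printing Implicit Defensive.

Import GRing.Theory.

Local Open Scope group_scope.

Definition isomorphic (G H : groupType) : Prop :=
  exists f : {multiplicative G -> H}, bijective f.

Definition zmod_isomorphic (A B : zmodType) : Prop :=
  exists f : {additive A -> B}, bijective f.

Definition factors_uniquely (X : Type) (P H : groupType)
    (phi : X -> P) (psi : X -> H) : Prop :=
  exists h : {multiplicative P -> H},
    h \o phi =1 psi /\
    forall h' : {multiplicative P -> H}, h' \o phi =1 psi -> h' =1 h.

Definition is_free_group (X : Type) (F : groupType) (x : X -> F) : Prop :=
  forall (H : groupType) (y : X -> H), factors_uniquely x y.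

Section Polynomial.
Variables G H : groupType.

Definition Delta (k : G) (phi : G -> H) : G -> H :=
  fun g => phi (k * g) * (phi g)^-1.

(* Degrees start at -1, so they are shifted by one:                           *)
(* [poly_lt n phi] says that phi is polynomial of degree n - 1.               *)
Fixpoint poly_lt (n : nat) (phi : G -> H) : Prop :=
  if n is m.+1 then forall k, poly_lt m (Delta k phi)
  else forall g, phi g = 1.

Definition quadratic (phi : G -> H) : Prop := poly_lt 3 phi.

Definition unital (phi : G -> H) : Prop := phi 1 = 1.

End Polynomial.

Definition is_Pol2 (G P : groupType) (phi : G -> P) : Prop :=
  [/\ unital phi, quadratic phi &
      forall (H : groupType) (psi : G -> H),
        unital psi -> quadratic psi -> factors_uniquely phi psi].

(* Semidirect product N ><| H of an additive abelian group N by H, with law   *)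
(* (n, g) (m, h) = (n + g . m, g h).                                          *)
Record zaction (H : groupType) (N : zmodType) := ZAction {
  zact :> H -> N -> N;
  zact1 : forall n, zact 1 n = n;
  zactM : forall g h n, zact (g * h) n = zact g (zact h n);
  zactD : forall g n m, zact g (n + m)%R = (zact g n + zact g m)%R
}.

(* An alias, since N * H itself carries the structure of a direct product.    *)
Definition sdprod (H : groupType) (N : zmodType) (a : zaction H N) : Type :=
  (N * H)%type.

Section Sdprod.
Variables (H : groupType) (N : zmodType) (a : zaction H N).
Implicit Types x y z : sdprod a.

HB.instance Definition _ := Choice.copy (sdprod a) (N * H)%type.

Definition sd_one : sdprod a := (0%R, 1).
Definition sd_mul x y : sdprod a := ((x.1 + a x.2 y.1)%R, x.2 * y.2).
Definition sd_inv x : sdprod a := ((- a x.2^-1%g x.1)%R, x.2^-1).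

Lemma sd_mulA : associative sd_mul.
Proof.
by move=> x y z; rewrite /sd_mul /= zactM zactD addrA mulgA.
Qed.

Lemma zact0 g : a g 0%R = 0%R.
Proof. by apply: (@addrI _ (a g 0%R)); rewrite -zactD !addr0. Qed.

Lemma zactN g n : a g (- n)%R = (- a g n)%R.
Proof. by apply: (@addrI _ (a g n)); rewrite -zactD !subrr zact0. Qed.

Lemma sd_mul1 : left_id sd_one sd_mul.
Proof. by case=> n g; rewrite /sd_mul /= zact1 add0r mul1g. Qed.

Lemma sd_mulr1 : right_id sd_one sd_mul.
Proof. by case=> n g; rewrite /sd_mul /= zact0 addr0 mulg1. Qed.

Lemma sd_mulV : left_inverse sd_one sd_inv sd_mul.
Proof. by case=> n g; rewrite /sd_mul /= addNr mulVg. Qed.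

Lemma sd_mulrV : right_inverse sd_one sd_inv sd_mul.
Proof. by case=> n g; rewrite /sd_mul /= zactN -zactM mulgV zact1 subrr. Qed.

HB.instance Definition _ := isGroup.Build (sdprod a)
  sd_mulA sd_mul1 sd_mulr1 sd_mulV sd_mulrV.

End Sdprod.

(* Z[F] is {malg int[F]}, whose elements are the finite sums of << n *g k >>  *)
(* (n : int, k : F); only its F-module structure is used.                     *)
Section GroupRing.
Variable F : groupType.
Implicit Types (a b : {malg int[F]}) (g h k : F).
Local Open Scope ring_scope.

Definition lmul g a : {malg int[F]} :=
  \sum_(k <- msupp a) << a@_k *g (g * k)%g >>.

Lemma mcoeff_lmul g a k : (lmul g a)@_k = a@_(g^-1 * k)%g.
Proof.
rewrite /lmul raddf_sum /= {3}[a]monalgE raddf_sum /=.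
apply: eq_bigr => h _; rewrite !mcoeffU; congr (_ *+ _).
by apply/esym; congr nat_of_bool; apply/eqP/eqP => [->|<-]; rewrite ?mulVKg ?mulKg.
Qed.

Lemma lmul1 a : lmul 1%g a = a.
Proof. by apply/malgP=> k; rewrite mcoeff_lmul invg1 mul1g. Qed.

Lemma lmulM g h a : lmul (g * h)%g a = lmul g (lmul h a).
Proof. by apply/malgP=> k; rewrite !mcoeff_lmul invgM mulgA. Qed.

Lemma lmulD g a b : lmul g (a + b) = lmul g a + lmul g b.
Proof. by apply/malgP=> k; rewrite mcoeffD !mcoeff_lmul mcoeffD. Qed.

Variable n : nat.
Implicit Types v w : {ffun 'I_n -> {malg int[F]}}.

Definition lmul_pow g v : {ffun 'I_n -> {malg int[F]}} :=
  [ffun i => lmul g (v i)].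

Lemma lmul_pow1 v : lmul_pow 1%g v = v.
Proof. by apply/ffunP=> i; rewrite ffunE lmul1. Qed.

Lemma lmul_powM g h v : lmul_pow (g * h)%g v = lmul_pow g (lmul_pow h v).
Proof. by apply/ffunP=> i; rewrite !ffunE lmulM. Qed.

Lemma lmul_powD g v w : lmul_pow g (v + w) = lmul_pow g v + lmul_pow g w.
Proof. by apply/ffunP=> i; rewrite !ffunE lmulD. Qed.

Definition lmul_action := ZAction lmul_pow1 lmul_powM lmul_powD.

End GroupRing.

Arguments lmul_action F n : clear implicits.

Inductive derived (G : groupType) : G -> Prop :=
| derivedR x y : derived [~ x, y]
| derived1 : derived 1
| derivedM x y : derived x -> derived y -> derived (x * y)
| derivedV x : derived x -> derived x^-1.

(* The quotient of G by its derived subgroup, written additively.             *)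
Section Abelianization.
Variable G : groupType.
Implicit Types x y z : G.
Local Open Scope quotient_scope.

Lemma derivedJ x y : derived x -> derived (x ^ y).
Proof.
by move=> dx; rewrite -[x ^ y](mulVKg x) -commgEl; apply: derivedM; [|constructor].
Qed.

Definition ab_rel x y := `[< derived (x / y) >].

Lemma ab_rel_refl : reflexive ab_rel.
Proof. by move=> x; apply/asboolP; rewrite mulgV; constructor. Qed.

Lemma ab_rel_sym : symmetric ab_rel.
Proof.
by move=> x y; apply/asboolP/asboolP => /derivedV; rewrite invgF.
Qed.

Lemma ab_rel_trans : transitive ab_rel.
Proof.
move=> y x z /asboolP dxy /asboolP dyz; apply/asboolP.
by rewrite -(divgKA y x z^-1); apply: derivedM.
Qed.

Canonical ab_equiv := EquivRel ab_rel ab_rel_refl ab_rel_sym ab_rel_trans.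

Definition abelianization := {eq_quot ab_equiv}.

HB.instance Definition _ := Choice.on abelianization.

Definition ab_pi x : abelianization := \pi_abelianization x.

Lemma ab_piP x y : ab_pi x = ab_pi y <-> derived (x / y).
Proof.
by split=> [/eqmodP/asboolP //|dxy]; apply/eqmodP/asboolP.
Qed.

Lemma ab_pi_surj (q : abelianization) : exists x, ab_pi x = q.
Proof. by exists (repr q); rewrite /ab_pi reprK. Qed.

Definition ab_zero : abelianization := ab_pi 1.
Definition ab_add (p q : abelianization) := ab_pi (repr p * repr q).
Definition ab_opp (p : abelianization) := ab_pi (repr p)^-1.

Lemma derived_repr x : derived (repr (ab_pi x) / x).
Proof. by apply/ab_piP; rewrite /ab_pi reprK. Qed.

Lemma ab_addE x y : ab_add (ab_pi x) (ab_pi y) = ab_pi (x * y).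
Proof.
apply/ab_piP; rewrite invgM.
set x' := repr _; set y' := repr _.
suff -> : x' * y' * (y^-1 * x^-1) = x' / x * (y' / y) ^ x^-1.
  by apply: derivedM; [|apply: derivedJ]; apply: derived_repr.
by rewrite conjgE invgK !mulgA mulgVK.
Qed.

Lemma ab_oppE x : ab_opp (ab_pi x) = ab_pi x^-1.
Proof.
apply/ab_piP; rewrite invgK.
set x' := repr _.
suff -> : x'^-1 * x = ((x' / x)^-1) ^ x.
  by apply: derivedJ; apply: derivedV; apply: derived_repr.
by rewrite conjgE invgF !mulgA mulVg mul1g.
Qed.

Lemma ab_addA : associative ab_add.
Proof.
move=> p q r; have [[x <-] [y <-] [z <-]] :=
  And3 (ab_pi_surj p) (ab_pi_surj q) (ab_pi_surj r).
by rewrite !ab_addE mulgA.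
Qed.

Lemma ab_addC : commutative ab_add.
Proof.
move=> p q; have [[x <-] [y <-]] := conj (ab_pi_surj p) (ab_pi_surj q).
rewrite !ab_addE; apply/ab_piP.
suff -> : x * y / (y * x) = [~ x^-1, y^-1] by constructor.
by rewrite /commg /conjg !invgK invgM !mulgA.
Qed.

Lemma ab_add0 : left_id ab_zero ab_add.
Proof. by move=> p; have [x <-] := ab_pi_surj p; rewrite ab_addE mul1g. Qed.

Lemma ab_addN : left_inverse ab_zero ab_opp ab_add.
Proof.
by move=> p; have [x <-] := ab_pi_surj p; rewrite ab_oppE ab_addE mulVg.
Qed.

HB.instance Definition _ := GRing.isZmodule.Build abelianization
  ab_addA ab_addC ab_add0 ab_addN.

Lemma ab_piM x y : ab_pi (x * y) = (ab_pi x + ab_pi y)%R.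
Proof. by rewrite -ab_addE. Qed.

Lemma ab_pi_eq0 x : ab_pi x = 0%R <-> derived x.
Proof. by rewrite -[0%R]/(ab_pi 1) ab_piP divg1. Qed.

End Abelianization.

(* Existence of free groups and of Pol_2(G): words on X modulo the equalities *)
(* that hold in every group under every map satisfying R.                     *)
Section Existence.
Variables (X : choiceType) (R : forall H : groupType, (X -> H) -> Prop).
Local Notation word := (seq (X * bool)).
Implicit Types u v w : word.
Local Open Scope quotient_scope.

Definition letter (H : groupType) (f : X -> H) (l : X * bool) : H :=
  if l.2 then (f l.1)^-1 else f l.1.

Definition weval (H : groupType) (f : X -> H) w : H := \prod_(l <- w) letter f l.

Definition winv w : word := rev [seq (l.1, ~~ l.2) | l <- w].

Lemma weval_cat (H : groupType) (f : X -> H) u v :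
  weval f (u ++ v) = weval f u * weval f v.
Proof. by rewrite /weval big_cat. Qed.

Lemma weval_inv (H : groupType) (f : X -> H) w : weval f (winv w) = (weval f w)^-1.
Proof.
elim: w => [|[x b] w IH]; first by rewrite /weval !big_nil invg1.
rewrite /winv /= rev_cons -cats1 weval_cat -/(winv w) IH /weval big_seq1 big_cons invgM.
by congr (_ * _); case: b; rewrite /letter /= ?invgK.
Qed.

Definition wrel u v :=
  `[< forall (H : groupType) (f : X -> H), R f -> weval f u = weval f v >].

Lemma wrel_refl : reflexive wrel.
Proof. by move=> u; apply/asboolP. Qed.

Lemma wrel_sym : symmetric wrel.
Proof. by move=> u v; apply/asboolP/asboolP => E H f /E ->. Qed.

Lemma wrel_trans : transitive wrel.
Proof.
by move=> v u w /asboolP E1 /asboolP E2; apply/asboolP => H f Rf; rewrite E1 ?E2.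
Qed.

Canonical w_equiv := EquivRel wrel wrel_refl wrel_sym wrel_trans.

Definition wquot := {eq_quot w_equiv}.

HB.instance Definition _ := Choice.on wquot.

Definition wpi w : wquot := \pi_wquot w.

Lemma wpiP u v :
  wpi u = wpi v <->
  forall (H : groupType) (f : X -> H), R f -> weval f u = weval f v.
Proof. by split=> [/eqmodP/asboolP //|E]; apply/eqmodP/asboolP. Qed.

Lemma wpi_surj (q : wquot) : exists w, wpi w = q.
Proof. by exists (repr q); rewrite /wpi reprK. Qed.

Lemma weval_repr (H : groupType) (f : X -> H) w :
  R f -> weval f (repr (wpi w)) = weval f w.
Proof. by move: H f; apply/wpiP; rewrite /wpi reprK. Qed.

Definition wone : wquot := wpi [::].
Definition wmul (p q : wquot) := wpi (repr p ++ repr q).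
Definition winvq (p : wquot) := wpi (winv (repr p)).

Lemma wmulE u v : wmul (wpi u) (wpi v) = wpi (u ++ v).
Proof. by apply/wpiP=> H f Rf; rewrite !weval_cat !weval_repr. Qed.

Lemma winvqE u : winvq (wpi u) = wpi (winv u).
Proof. by apply/wpiP=> H f Rf; rewrite !weval_inv weval_repr. Qed.

Lemma wmulA : associative wmul.
Proof.
move=> p q r; have [[x <-] [y <-] [z <-]] :=
  And3 (wpi_surj p) (wpi_surj q) (wpi_surj r).
by rewrite !wmulE catA.
Qed.

Lemma wmul1 : left_id wone wmul.
Proof. by move=> p; have [x <-] := wpi_surj p; rewrite wmulE. Qed.

Lemma wmulr1 : right_id wone wmul.
Proof. by move=> p; have [x <-] := wpi_surj p; rewrite wmulE cats0. Qed.

Lemma wmulV : left_inverse wone winvq wmul.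
Proof.
move=> p; have [x <-] := wpi_surj p; rewrite winvqE wmulE.
by apply/wpiP=> H f _; rewrite weval_cat weval_inv mulVg /weval big_nil.
Qed.

Lemma wmulrV : right_inverse wone winvq wmul.
Proof.
move=> p; have [x <-] := wpi_surj p; rewrite winvqE wmulE.
by apply/wpiP=> H f _; rewrite weval_cat weval_inv mulgV /weval big_nil.
Qed.

HB.instance Definition _ := isGroup.Build wquot wmulA wmul1 wmulr1 wmulV wmulrV.

Definition wgen (x : X) : wquot := wpi [:: (x, false)].

Lemma weval_wgen w : weval wgen w = wpi w.
Proof.
elim: w => [|[x b] w IH]; first by rewrite /weval big_nil.
rewrite /weval big_cons -/(weval wgen w) IH -cat1s -wmulE; congr (_ * _).
by case: b => //; exact: (winvqE [:: (x, false)]).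
Qed.

Lemma multiplicative_weval (P H : groupType) (h : {multiplicative P -> H})
    (g : X -> P) (f : X -> H) w :
  h \o g =1 f -> h (weval g w) = weval f w.
Proof.
move=> hgf; have h1 : h 1 = 1 by apply: (mulgI (h 1)); rewrite -gmulfM !mulg1.
have hV y : h y^-1 = (h y)^-1.
  by apply: (mulgI (h y)); rewrite -gmulfM !mulgV.
elim: w => [|[x b] w IH]; first by rewrite /weval !big_nil.
rewrite /weval !big_cons gmulfM; congr (_ * _); last exact: IH.
by case: b; rewrite /letter /= ?hV -hgf.
Qed.

Lemma wgen_universal (H : groupType) (f : X -> H) : R f -> factors_uniquely wgen f.
Proof.
move=> Rf; pose h (p : wquot) := weval f (repr p).
have hM : {morph h : p q / p * q}.
  move=> p q; exact: etrans (weval_repr (repr p ++ repr q) Rf) (weval_cat f _ _).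
pose hh : {multiplicative wquot -> H} :=
  HB.pack h (monoid.isMultiplicative.Build _ _ h hM).
have hgen : hh \o wgen =1 f.
  by move=> x; rewrite /= /h weval_repr // /weval big_seq1.
exists hh; split=> // h' h'gen p.
have [w <-] := wpi_surj p; rewrite -weval_wgen.
by rewrite (multiplicative_weval _ h'gen) (multiplicative_weval _ hgen).
Qed.

Lemma wgen_separated (p q : wquot) :
  (forall (H : groupType) (h : {multiplicative wquot -> H}),
     R (h \o wgen) -> h p = h q) -> p = q.
Proof.
have [[u <-] [v <-]] := conj (wpi_surj p) (wpi_surj q) => E.
apply/wpiP => H f Rf; have [h [hgen _]] := wgen_universal Rf.
rewrite -!(multiplicative_weval _ hgen) !weval_wgen; apply: E.
by rewrite (_ : h \o wgen = f) //; apply: funext.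
Qed.

End Existence.

Lemma free_group_exists (X : choiceType) :
  exists (F : groupType) (x : X -> F), is_free_group x.
Proof.
exists (wquot (fun H (f : X -> H) => True)), (@wgen _ _) => H y.
exact: wgen_universal.
Qed.

Lemma Pol2_exists (G : groupType) :
  exists (P : groupType) (phi : G -> P), is_Pol2 phi.
Proof.
pose R (H : groupType) (f : G -> H) := unital f /\ quadratic f.
have sep := @wgen_separated G R.
exists (wquot R), (@wgen _ R); split.
- by apply: sep => H h [u _]; rewrite [LHS]u; apply/esym/(mulgI (h 1)); rewrite -gmulfM !mulg1.
- move=> a b c g; apply: sep => H h [_ q].
  have h1 : h 1 = 1 by apply: (mulgI (h 1)); rewrite -gmulfM !mulg1.
  have hV y : h y^-1 = (h y)^-1.
    by apply: (mulgI (h y)); rewrite -gmulfM !mulgV.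
  by rewrite h1 -(q a b c g) /Delta /= !(gmulfM, hV).
- by move=> H psi u q; apply: wgen_universal.
Qed.

(* Main.v *)
Require Import Defs.
From mathcomp Require Import all_boot all_order all_algebra.
From mathcomp Require Import finmap monalg.
From HB Require Import structures.
From mathcomp Require Import boolp.

(* For a unital quadratic map phi, put                                        *)
(*   c k g = phi (k * g) / phi g / phi k,                                     *)
(* which is multiplicative in g. Comparing the two ways of expanding          *)
(* phi (k * l * g) shows that c k h commutes with the conjugate of c l g by   *)
(* phi k; taking l = k^-1, the image of each c k is abelian, so that          *)
(*   c (k * l) g = c k g * phi k * c l g * (phi k)^-1,                        *)
(* and then all the values of c commute with each other and their conjugates  *)
(* by phi k are products of values of c. Hence on a free group phi is         *)
(* determined by the elements phi (x i) and c (x i) (x j), and the normal     *)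
(* closure of the latter is abelian, hence a module over Z[F].                *)
(* Conversely, a module M and elements m i j of M define a quadratic map from *)
(* F to M ><| F with c (x i) (x j) = m i j, by means of Fox derivatives.      *)
(* Taking M to be Z[F]^(d^2) gives Pol_2(F), and taking M to be Z^(d^2) with  *)
(* the trivial action gives its abelianization.                               *)

Set Implicit Arguments.
Unset Strict Implicit.
Unset Printing Implicit Defensive.

Import GRing.Theory.

(** A quadratic map on a free group amounts to free data: the values [phi (x i)] and the defects at
    the pairs [(x i, x j)]. Uniqueness is [quadratic_ext], hence [Pol2_hom_ext]: a homomorphism out
    of [P] is determined on these d + d^2 elements. Existence is [free_quadratic], hence
    [sdprod_quadratic] for maps into M ><| F.

    For [Pol2_sdprod], the universal property of [P] gives [h] from [P] to Z[F]^(d^2) ><| F. For the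
    map back, [defect_module] places the defects in an abelian group on which F acts by conjugation
    through the homomorphism [s] with [s (x i) = phi (x i)]. Since Z[F]^(d^2) is a free module
    ([monomial_vec_universal]), the defects define an equivariant map [t], and (v, g) goes to
    [i (t v) * s g]. Both composites are the identity on generators. [Pol2_abelianization] runs the
    same comparison with the abelian group Z^(d^2) + Z^d. *)

Section Morphisms.
Local Open Scope group_scope.

Definition mul_pack (G H : groupType) (f : G -> H)
    (fM : {morph f : x y / x * y}) : {multiplicative G -> H} :=
  HB.pack f (monoid.isMultiplicative.Build G H f fM).

Definition add_pack (U V : zmodType) (f : U -> V)
    (fD : {morph f : x y / (x + y)%R}) : {additive U -> V} :=
  HB.pack f (GRing.isZmodMorphism.Build U V f (fun x y =>
    canRL (addrK _) (etrans (esym (fD _ _)) (congr1 f (subrK y x))))).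

Variables (G H : groupType) (h : {multiplicative G -> H}).

Lemma multiplicative1 : h 1 = 1.
Proof. by apply: (mulgI (h 1)); rewrite -gmulfM !mulg1. Qed.

Lemma multiplicativeV : {morph h : x / x^-1}.
Proof.
by move=> x; apply: (mulgI (h x)); rewrite -gmulfM !mulgV multiplicative1.
Qed.

End Morphisms.

Lemma to_multiplicativeD (A : zmodType) (H : groupType)
    (i : {multiplicative Algebra.to_multiplicative A -> H}) (y z : A) :
  i (y + z)%R = (i y * i z)%g.
Proof. by rewrite -gmulfM. Qed.

(** * Defects of quadratic maps *)

Section Quadratic.
Local Open Scope group_scope.

Definition defect (G H : groupType) (phi : G -> H) (k g : G) : H :=
  phi (k * g) / phi g / phi k.

Lemma defectE (G H : groupType) (phi : G -> H) k g :
  phi (k * g) = defect phi k g * phi k * phi g.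
Proof. by rewrite /defect !mulgVK. Qed.

Lemma defect_comp (G H K : groupType) (phi : G -> H)
    (h : {multiplicative H -> K}) k g :
  defect (h \o phi) k g = h (defect phi k g).
Proof. by rewrite /defect /= !gmulfM !multiplicativeV. Qed.

Lemma quadratic_comp (G H K : groupType) (phi : G -> H)
    (h : {multiplicative H -> K}) :
  quadratic phi -> quadratic (h \o phi).
Proof.
move=> q a b c g; rewrite -(multiplicative1 h) -(q a b c g) /Delta /=.
by rewrite !(gmulfM, multiplicativeV).
Qed.

Lemma unital_comp (G H K : groupType) (phi : G -> H)
    (h : {multiplicative H -> K}) :
  unital phi -> unital (h \o phi).
Proof. by rewrite /unital /= => ->; apply: multiplicative1. Qed.

(** [Delta k psi] is a homomorphism times the constant [psi k], so its differences are constant. *)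
Lemma quadraticP (G H : groupType) (psi : G -> H) (c : G -> G -> H) :
  (forall k, {morph c k : g h / g * h}) ->
  (forall k g, psi (k * g) = c k g * psi k * psi g) ->
  [/\ unital psi, quadratic psi & forall k g, defect psi k g = c k g].
Proof.
move=> cM psiM; have dE k g : Delta k psi g = c k g * psi k.
  by rewrite /Delta psiM mulgK.
split.
- have c11 : c 1 1 = 1 by apply: (mulgI (c 1 1)); rewrite -cM !mulg1.
  by move: (psiM 1 1); rewrite mulg1 c11 mul1g -{1}[psi 1]mulg1 => /mulgI.
- move=> k l m g; rewrite /Delta -/(Delta k psi _).
  rewrite -![psi (k * _) / _]/(Delta k psi _) !dE !cM -!mulgA.
  by rewrite !invgM !mulgA !mulgK !invgK -!mulgA mulVKg !mulgA mulgK mulgV.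
- by move=> k g; rewrite /defect psiM !mulgK.
Qed.

Section Defect.
Variables (G H : groupType) (phi : G -> H).
Hypotheses (phi1 : unital phi) (phi2 : quadratic phi).
Local Notation c := (defect phi).

Lemma defectM k : {morph c k : g h / g * h}.
Proof.
move=> l m; move: (phi2 k l m 1); set psi := Delta k phi => /divg1_eq.
have psi1 : psi 1 = phi k by rewrite /psi /Delta mulg1 phi1 divg1.
rewrite /Delta !mulg1 psi1 => E.
have -> : c k (l * m) = psi (l * m) / phi k by [].
by rewrite -[psi (l * m)](mulgVK (psi m)) E -!mulgA.
Qed.

Lemma defectg1 k : c k 1 = 1.
Proof. by apply: (mulgI (c k 1)); rewrite -defectM !mulg1. Qed.

Lemma defectV k g : c k g^-1 = (c k g)^-1.
Proof. by apply: (mulgI (c k g)); rewrite -defectM !mulgV defectg1. Qed.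

Lemma defect1g g : c 1 g = 1.
Proof. by rewrite /defect mul1g mulgV phi1 mulgV. Qed.

Lemma defect_conj_cocycle k l g :
  c (k * l) g ^ c k l = c k g * c l g ^ (phi k)^-1.
Proof.
rewrite conjgE; apply: (canLR (mulKg _)).
apply: (mulIg (phi k)); apply: (mulIg (phi l)); apply: (mulIg (phi g)).
transitivity (phi (k * l * g)).
  by rewrite (defectE phi (k * l)) (defectE phi k l) !mulgA.
rewrite -(mulgA k l g) (defectE phi k) defectM (defectE phi l g) conjgE invgK.
rewrite !mulgA.
by rewrite !mulgVK.
Qed.

(* Both sides of [defect_conj_cocycle] and both factors on its right are      *)
(* multiplicative in [g].                                                     *)
Lemma defect_commute_conj k l g h : commute (c k h) (c l g ^ (phi k)^-1).
Proof.
have := defect_conj_cocycle k l (g * h).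
rewrite defectM conjMg !defect_conj_cocycle !defectM conjMg.
move: (c k g) (c k h) (_ ^ _) (_ ^ _) => a b p q.
by rewrite -!mulgA => /mulgI; rewrite !mulgA => /mulIg E; apply: esym.
Qed.

(** Undo the conjugation by [c k l] in [defect_conj_cocycle]: on [c k g] it moves inside the
    argument because [c k] is multiplicative, and on the other factor it is trivial by
    [defect_commute_conj]. *)
Lemma defect_twisted_cocycle k l g :
  c (k * l) g = c k (g ^ l^-1) * c l g ^ (phi k)^-1.
Proof.
apply: (conjg_inj (c k l)); rewrite defect_conj_cocycle conjMg.
have /conjg_fixP -> : [~ c l g ^ (phi k)^-1, c k l] == 1.
  by apply/commgP/esym/defect_commute_conj.
congr (_ * _); rewrite !conjgE invgK !defectM defectV.
by move: (c k g) (c k l) => a b; rewrite -!mulgA mulVg mulg1 mulKg.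
Qed.

Lemma defect_commute_same k g h : commute (c k h) (c k g).
Proof.
(* The left side is a value of [c 1], hence trivial, so [c k g] is the inverse of a conjugate to
   which [defect_commute_conj] applies. *)
have E := defect_twisted_cocycle k k^-1 (g ^ k^-1).
rewrite mulgV defect1g invgK conjgKV in E.
have -> : c k g = (c k^-1 (g ^ k^-1) ^ (phi k)^-1)^-1.
  by apply/eqP; rewrite -mulg_eq1 -E.
by apply: commuteV; apply: defect_commute_conj.
Qed.

Lemma defect_cocycle k l g : c (k * l) g = c k g * c l g ^ (phi k)^-1.
Proof.
rewrite defect_twisted_cocycle; congr (_ * _).
rewrite conjgE invgK !defectM defectV mulgA.
by rewrite defect_commute_same mulgK.
Qed.

Lemma defect_conj k l g : c l g ^ (phi k)^-1 = (c k g)^-1 * c (k * l) g.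
Proof. by rewrite defect_cocycle mulKg. Qed.

Lemma defect_commute k l g h : commute (c k g) (c l h).
Proof.
have -> : c l h = c k h * c (k^-1 * l) h ^ (phi k)^-1.
  by rewrite -defect_cocycle mulVKg.
by apply: commuteM; [apply: defect_commute_same | apply: defect_commute_conj].
Qed.

End Defect.
End Quadratic.

(** * Subgroups, and uniqueness of maps on free groups *)

Section Subgroups.
Local Open Scope group_scope.

Lemma subgroup_groupType (H : groupType) (S : H -> Prop) :
  S 1 -> (forall y z, S y -> S z -> S (y * z)) -> (forall y, S y -> S y^-1) ->
  exists (K : groupType) (i : {multiplicative K -> H}),
    injective i /\ forall y, S y <-> exists a, i a = y.
Proof.
move=> S1 SM SV; pose T := {y : H | `[< S y >]}.
pose mk y (Sy : S y) : T := exist _ y (asboolT Sy).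
pose tS (t : T) : S (val t) := asboolW (valP t).
pose one := mk 1 S1.
pose mul t u := mk _ (SM _ _ (tS t) (tS u)).
pose inv t := mk _ (SV _ (tS t)).
have mulA : associative mul by move=> t u v; apply: val_inj; apply: mulgA.
have mul1 : left_id one mul by move=> t; apply: val_inj; apply: mul1g.
have mulr1 : right_id one mul by move=> t; apply: val_inj; apply: mulg1.
have mulV : left_inverse one inv mul.
  by move=> t; apply: val_inj; apply: mulVg.
have mulrV : right_inverse one inv mul.
  by move=> t; apply: val_inj; apply: mulgV.
pose K : groupType := HB.pack T (isGroup.Build T mulA mul1 mulr1 mulV mulrV).
have iM : {morph (fun t : K => val (t : T)) : t u / t * u} by [].
exists K, (mul_pack iM).
split=> [|y]; first by move=> t u; apply: val_inj.
by split=> [Sy|[t <-]]; [exists (mk y Sy) | apply: tS].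
Qed.

Lemma abelian_zmodType (K : groupType) :
  (forall a b : K, commute a b) ->
  exists (A : zmodType) (i : {multiplicative Algebra.to_multiplicative A -> K}),
    bijective i.
Proof.
move=> KC.
pose A : zmodType := HB.pack (Group.sort K)
  (GRing.isZmodule.Build (Group.sort K) (@mulgA K) KC (@mul1g K) (@mulVg K)).
have iM : {morph (fun a : Algebra.to_multiplicative A => (a : K)) :
    a b / a * b} by [].
exists A, (mul_pack iM).
by exists id.
Qed.

Definition mul_comp (G H K : groupType) (f : {multiplicative H -> K})
  (g : {multiplicative G -> H}) : {multiplicative G -> K} := f \o g.

Lemma free_group_ext (I : Type) (F : groupType) (x : I -> F) (H : groupType)
    (f g : {multiplicative F -> H}) :
  is_free_group x -> (forall i, f (x i) = g (x i)) -> f =1 g.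
Proof.
move=> freeF fg; have [h [_ hU]] := freeF H (g \o x).
by move=> y; rewrite (hU f) ?(hU g).
Qed.

(** Freeness maps F into the subgroup cut out by [S]; followed by the inclusion, this fixes the
    generators, so it is the identity and [S] is everything. *)
Lemma free_group_ind (I : Type) (F : groupType) (x : I -> F) (S : F -> Prop) :
  is_free_group x ->
  S 1 -> (forall y z, S y -> S z -> S (y * z)) -> (forall y, S y -> S y^-1) ->
  (forall i, S (x i)) -> forall y, S y.
Proof.
move=> freeF S1 SM SV Sx y; have [K [i [_ iP]]] := subgroup_groupType S1 SM SV.
have /choice [xK xKE] j : exists a, i a = x j by apply/iP.
have [h [hx _]] := freeF K xK.
have E : mul_comp i h =1 (idfun : {multiplicative F -> F}).
  by apply: (free_group_ext freeF) => j; rewrite /= [h _]hx.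
by apply/iP; exists (h y); apply: E.
Qed.

(** The [k] at which both the values and the whole maps [defect _ k] agree form a subgroup, by the
    cocycle identity. It contains each [x i] because [defect _ (x i)] is itself multiplicative. *)
Lemma quadratic_ext (I : Type) (F : groupType) (x : I -> F) (H : groupType)
    (phi psi : F -> H) :
  is_free_group x -> unital phi -> quadratic phi -> unital psi ->
  quadratic psi -> (forall i, phi (x i) = psi (x i)) ->
  (forall i j, defect phi (x i) (x j) = defect psi (x i) (x j)) -> phi =1 psi.
Proof.
move=> freeF phi1 phi2 psi1 psi2 Ex Ed.
suff S k : phi k = psi k /\ defect phi k =1 defect psi k.
  by move=> k; case: (S k).
move: k; apply: (free_group_ind freeF).
- by split=> [|g]; rewrite ?phi1 ?psi1 // !defect1g.
- move=> k l [Ek Edk] [El Edl]; split=> [|g].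
    by rewrite !(@defectE _ _ _ k) Edk Ek El.
  by rewrite !defect_cocycle // Edk Edl Ek.
- move=> k [Ek Edk].
  (* Conjugation by [(phi k)^-1] takes the defects at [k^-1] to inverses of those at [k]; expanding
     [phi (k * k^-1) = 1] then determines [phi k^-1]. *)
  have EdV : defect phi k^-1 =1 defect psi k^-1.
    move=> g; apply: (conjg_inj (phi k)^-1); rewrite [in RHS]Ek.
    by rewrite !defect_conj // mulgV !defect1g // Edk.
  split=> //; apply: (mulgI (defect phi k k^-1 * phi k)).
  by rewrite -defectE [in RHS]Edk Ek -defectE mulgV phi1 psi1.
- move=> i; split=> //; apply: (free_group_ind freeF) => [|g h Eg Eh|g Eg|//].
  + by rewrite !defectg1.
  + by rewrite !defectM // Eg Eh.
  + by rewrite !defectV // Eg.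
Qed.

Lemma Pol2_hom_ext (I : Type) (F P H : groupType) (x : I -> F) (phi : F -> P)
    (f g : {multiplicative P -> H}) :
  is_free_group x -> is_Pol2 phi ->
  (forall i, f (phi (x i)) = g (phi (x i))) ->
  (forall i j, f (defect phi (x i) (x j)) = g (defect phi (x i) (x j))) ->
  f =1 g.
Proof.
move=> freeF [phi1 phi2 phiU] Ex Ed.
have uc (h : {multiplicative P -> H}) := unital_comp h phi1.
have qc (h : {multiplicative P -> H}) := quadratic_comp h phi2.
have E : f \o phi =1 g \o phi.
  apply: (quadratic_ext freeF) => // i j.
  by rewrite !defect_comp.
have [h [_ hU]] := phiU H (g \o phi) (uc g) (qc g).
by move=> p; rewrite (hU f) ?(hU g).
Qed.

End Subgroups.

(** * Fox derivatives and the construction of quadratic maps *)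

Section Existence.
Local Open Scope ring_scope.

(** A derivation is the first component of a homomorphic section of M ><| F -> F, and freeness lifts
    generators to any [(m i, x i)]. *)
Lemma free_derivation (I : Type) (F : groupType) (x : I -> F) (M : zmodType)
    (a : zaction F M) (m : I -> M) :
  is_free_group x ->
  exists D : F -> M, (forall i, D (x i) = m i) /\
    forall g h, D (g * h)%g = D g + a g (D h).
Proof.
move=> freeF; have [f [fx _]] := freeF (sdprod a) (fun i => (m i, x i)).
have sndM : {morph (fun y : sdprod a => y.2) : y z / (y * z)%g} by [].
have E : mul_comp (mul_pack sndM) f =1 (idfun : {multiplicative F -> F}).
  by apply: (free_group_ext freeF) => i; rewrite /= [f _]fx.
exists (fun g => (f g).1); split=> [i|g h]; first by rewrite [f _]fx.
by rewrite gmulfM /= [(f g).2]E.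
Qed.

Definition unit_vec (J : finType) (j : J) : {ffun J -> int} :=
  [ffun k => (k == j)%:R].

Lemma sum_unit_vec (J : finType) (v : {ffun J -> int}) :
  \sum_j unit_vec j *~ v j = v.
Proof.
apply/ffunP=> k; rewrite sum_ffunE (bigD1 k) //= big1 => [|j jk].
  by rewrite ffunMzE ffunE eqxx addr0 intz.
by rewrite ffunMzE ffunE eq_sym (negbTE jk) mul0rz.
Qed.

Lemma sum_coef_unit_vec (J : finType) (V : zmodType) (w : J -> V) (i : J) :
  \sum_j w j *~ unit_vec i j = w i.
Proof.
rewrite (bigD1 i) //= ffunE eqxx mulr1z big1 ?addr0 // => j ji.
by rewrite ffunE (negbTE ji).
Qed.

(* A quadratic map [n] with defect [c k g = \sum_j e g j * b j k] is the      *)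
(* first component of a derivation into [M + Z^I], on which [k] acts by the   *)
(* unipotent matrix with off-diagonal entries [b j k].                        *)
Lemma free_quadratic (I : finType) (F : groupType) (x : I -> F) (M : zmodType)
    (a : zaction F M) (m : I -> I -> M) :
  is_free_group x ->
  exists (n : F -> M) (e : F -> {ffun I -> int}) (c : F -> F -> M),
    [/\ forall k g, n (k * g)%g = c k g + n k + a k (n g),
        forall k g h, c k (g * h)%g = c k g + c k h,
        forall g h, e (g * h)%g = e g + e h,
        forall i, n (x i) = 0 /\ e (x i) = unit_vec i &
        forall i j, c (x i) (x j) = m i j].
Proof.
move=> freeF.
have /choice [b bP] j := free_derivation a (m^~ j) freeF.
pose c k (z : {ffun I -> int}) := \sum_j b j k *~ z j.
have cD k z w : c k (z + w) = c k z + c k w.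
  by rewrite -big_split; apply: eq_bigr => j _; rewrite ffunE mulrzDr.
have aMz k y z : a k (y *~ z) = a k y *~ z.
  by apply: (raddfMz (add_pack (zactD a k))).
have c1 z : c 1%g z = 0.
  apply: big1 => j _; have := (bP j).2 1%g 1%g.
  by rewrite mulg1 zact1 -[LHS]addr0 => /addrI <-; rewrite mul0rz.
have cM g h z : c (g * h)%g z = c g z + a g (c h z).
  (* The derivation rule for each [b j] gives this identity, which is what makes the triangular maps
     [act] compose as an action. *)
  rewrite /c [a g _](raddf_sum (add_pack (zactD a g))) -big_split.
  by apply: eq_bigr => j _; rewrite /= (bP j).2 aMz mulrzDl.
pose E : zmodType := (M * {ffun I -> int})%type.
pose act g (y : E) : E := (a g y.1 + c g y.2, y.2).
have act1 y : act 1%g y = y.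
  by case: y => y z; rewrite /act /= zact1 c1 addr0.
have actM g h y : act (g * h)%g y = act g (act h y).
  by rewrite /act /= zactM cM zactD -!addrA [c g _ + _]addrC.
have actD g y z : act g (y + z) = act g y + act g z.
  by rewrite /act /= zactD cD addrACA.
have [D [Dx DM]] :=
  free_derivation (ZAction act1 actM actD) (fun i => (0, unit_vec i)) freeF.
exists (fun g => (D g).1), (fun g => (D g).2), (fun k g => c k (D g).2).
split=> [k g|k g h|g h|i|i j].
- by rewrite DM /= addrA addrC addrA.
- by rewrite DM /= cD.
- by rewrite DM.
- by rewrite Dx.
- by rewrite Dx /c sum_coef_unit_vec (bP j).1.
Qed.

End Existence.

(** * Quadratic maps into semidirect products, and free Z[F]-modules *)

Section SemidirectProduct.
Local Open Scope group_scope.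

Lemma sdprod_quadratic (I : finType) (F : groupType) (x : I -> F) (M : zmodType)
    (a : zaction F M) (m : I -> I -> M) :
  is_free_group x ->
  exists psi : F -> sdprod a,
    [/\ unital psi, quadratic psi, forall i, psi (x i) = (0%R, x i) &
        forall i j, defect psi (x i) (x j) = (m i j, 1)].
Proof.
move=> freeF; have [n [e [c [nM cD _ n0 cx]]]] := free_quadratic a m freeF.
pose psi g : sdprod a := (n g, g).
have cM k : {morph (fun g => (c k g, 1) : sdprod a) : g h / g * h}.
  by move=> g h; rewrite cD; congr (_, _); rewrite /= ?zact1 // mulg1.
have psiM k g : psi (k * g) = ((c k g, 1) : sdprod a) * psi k * psi g.
  by congr (_, _); rewrite /= mul1g // zact1 nM.
have [psi1 psi2 psic] := quadraticP cM psiM.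
by exists psi; split=> // [i|i j]; rewrite ?psic ?cx // /psi (n0 i).1.
Qed.

(** The group element [g] in the [j]-th copy of Z[F]; the other coordinates are monomials with
    coefficient 0, hence zero. *)
Definition monomial_vec (F : groupType) (r : nat) (j : 'I_r) (g : F) :
    {ffun 'I_r -> {malg int[F]}} :=
  [ffun k => << (k == j)%:R *g g >>]%R.

Lemma lmulU (F : groupType) (g h : F) (z : int) :
  lmul g << z *g h >>%R = << z *g (g * h)%g >>%R.
Proof.
apply/malgP=> k; rewrite mcoeff_lmul !mcoeffU; congr (_ *+ _)%R.
by congr nat_of_bool; apply/eqP/eqP => [->|<-]; rewrite ?mulKg ?mulVKg.
Qed.

Lemma lmul_pow_monomial (F : groupType) (r : nat) (j : 'I_r) (g h : F) :
  lmul_pow g (monomial_vec j h) = monomial_vec j (g * h).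
Proof. by apply/ffunP=> k; rewrite !ffunE lmulU. Qed.

Local Open Scope ring_scope.

Lemma monomial_vec_sum (F : groupType) (r : nat)
    (v : {ffun 'I_r -> {malg int[F]}}) :
  v = \sum_j \sum_(k <- msupp (v j)) monomial_vec j k *~ (v j)@_k.
Proof.
apply/ffunP=> i; rewrite sum_ffunE (bigD1 i) //= [X in _ + X]big1 => [|j ji].
  rewrite addr0 sum_ffunE {1}[v i]monalgE; apply: eq_bigr => k _.
  by rewrite ffunMzE ffunE eqxx -(raddfMz (mkmalgU k)) intz.
rewrite sum_ffunE big1 // => k _.
by rewrite ffunMzE ffunE eq_sym (negbTE ji) monalgU0 mul0rz.
Qed.

Lemma monomial_vec_ind (F : groupType) (r : nat)
    (Q : {ffun 'I_r -> {malg int[F]}} -> Prop) :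
  Q 0 -> (forall v w, Q v -> Q w -> Q (v + w)) -> (forall v, Q v -> Q (- v)) ->
  (forall j g, Q (monomial_vec j g)) -> forall v, Q v.
Proof.
move=> Q0 QD QN Qm v; rewrite [v]monomial_vec_sum.
apply: big_ind => // j _; apply: big_ind => // k _.
have QMn w n : Q w -> Q (w *+ n).
  by move=> Qw; elim: n => // n IH; rewrite mulrS; apply: QD.
by case: (_@_k) => n; [|rewrite NegzE mulrNz; apply: QN]; apply: QMn.
Qed.

(** Z[F]^r is the free Z[F]-module on the vectors [monomial_vec j 1]: the map sends
    [monomial_vec j g] to [a g (w j)] and extends additively. *)
Lemma monomial_vec_universal (F : groupType) (r : nat) (A : zmodType)
    (a : zaction F A) (w : 'I_r -> A) :
  exists t : {additive {ffun 'I_r -> {malg int[F]}} -> A},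
    (forall g v, t (lmul_pow g v) = a g (t v)) /\
    forall j, t (monomial_vec j 1%g) = w j.
Proof.
pose f j (u : {malg int[F]}) := \sum_(k <- msupp u) a k (w j) *~ u@_k.
(* Enlarging the index set lets [u], [v] and [u + v] be summed over one common set, the union of the
   supports. *)
have fE j (D : {fset F}) u : (msupp u `<=` D)%fset ->
    f j u = \sum_(k <- D) a k (w j) *~ u@_k.
  move=> uD; rewrite /f (big_fset_incl _ uD) // => k _ /mcoeff_outdom ->.
  by rewrite mulr0z.
have fD j : {morph f j : u v / u + v}.
  move=> u v; have uv := msuppD_le u v.
  rewrite (fE j _ _ uv) (fE j _ u (fsubsetUl _ (msupp v))).
  rewrite (fE j _ v (fsubsetUr (msupp u) _)) -big_split.
  by apply: eq_bigr => k _; rewrite mcoeffD mulrzDr.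
have fU j z k : f j << z *g k >> = a k (w j) *~ z.
  by rewrite (fE j _ _ msuppU_le) big_seq_fset1 mcoeffUU.
have tD : {morph (fun v : {ffun 'I_r -> {malg int[F]}} => \sum_j f j (v j)) :
    u v / u + v}.
  by move=> u v; rewrite -big_split; apply: eq_bigr => j _; rewrite ffunE fD.
have tm j g : add_pack tD (monomial_vec j g) = a g (w j).
  rewrite /= (bigD1 j) //= ffunE eqxx fU mulr1z big1 ?addr0 // => k kj.
  by rewrite ffunE (negbTE kj) fU mulr0z.
exists (add_pack tD); split=> [g|j]; last by rewrite tm zact1.
set t := add_pack tD.
pose lm := add_pack (@lmul_powD F r g).
have lm0 : lmul_pow g 0 = 0 := raddf0 lm.
have lmN v : lmul_pow g (- v) = - lmul_pow g v := raddfN lm v.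
apply: monomial_vec_ind => [|u v Eu Ev|v Ev|j h].
- by rewrite lm0 raddf0 zact0.
- by rewrite lmul_powD raddfD Eu Ev -zactD -raddfD.
- by rewrite lmN raddfN Ev raddfN zactN.
- by rewrite lmul_pow_monomial !tm zactM.
Qed.

End SemidirectProduct.

(** * The abelian normal subgroup containing the defects *)

Section AbelianKernel.
Local Open Scope group_scope.

Lemma commuteJ (G : groupType) (y z g : G) :
  commute y z <-> commute (y ^ g) (z ^ g).
Proof.
by rewrite /commute -!conjMg; split=> [->|/conjg_inj].
Qed.

(** Conjugation in the direction opposite to [defect_conj]. It needs its own formula, since
    [phi k^-1] may differ from [(phi k)^-1]. *)
Lemma defect_conjV (G H : groupType) (phi : G -> H) k l g :
  unital phi -> quadratic phi ->
  defect phi l g ^ phi k = (defect phi k^-1 g)^-1 * defect phi (k^-1 * l) g.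
Proof.
move=> phi1 phi2; apply: (conjg_inj (phi k)^-1).
rewrite conjgK conjMg conjVg !defect_conj // mulgV defect1g // mulg1 invgK.
by rewrite !mulVKg.
Qed.

(* The double centralizer of the defects is abelian because they commute, and *)
(* normal because their conjugates are products of defects.                   *)
Lemma defect_module (I : Type) (F H : groupType) (x : I -> F) (phi : F -> H)
    (s : {multiplicative F -> H}) :
  is_free_group x -> unital phi -> quadratic phi ->
  (forall i, s (x i) = phi (x i)) ->
  exists (A : zmodType) (i : {multiplicative Algebra.to_multiplicative A -> H})
    (a : zaction F A),
    (forall g y, i (a g y) = i y ^ (s g)^-1) /\
    forall k g, exists y, i y = defect phi k g.
Proof.
move=> freeF phi1 phi2 sx.
pose C z := forall k g, commute z (defect phi k g).
pose S y := forall z, C z -> commute y z.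
have CJ k z : C z -> C (z ^ phi k).
  move=> Cz l g; apply/(commuteJ _ _ (phi k)^-1); rewrite conjgK defect_conj //.
  by apply: commuteM; [apply: commuteV|]; apply: Cz.
have CJV k z : C z -> C (z ^ (phi k)^-1).
  move=> Cz l g; apply/(commuteJ _ _ (phi k)); rewrite conjgKV defect_conjV //.
  by apply: commuteM; [apply: commuteV|]; apply: Cz.
(* As an equivalence the claim passes to inverses, so it need only be checked on generators, where
   [s] agrees with [phi]. *)
have SJ g y : S y <-> S (y ^ (s g)^-1).
  move: g y; apply: (free_group_ind freeF) => [y|g h Sg Sh y|g Sg y|j y].
  - by rewrite multiplicative1 invg1 conjg1.
  - by rewrite gmulfM invgM conjgM -Sg.
  - by rewrite multiplicativeV invgK (Sg (y ^ s g)) conjgK.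
  - rewrite sx; split=> Sy z Cz.
      apply/(commuteJ _ _ (phi (x j))); rewrite conjgKV.
      by apply: Sy; apply: CJ.
    by apply/(commuteJ _ _ (phi (x j))^-1); apply: Sy; apply: CJV.
have Sd k g : S (defect phi k g) by move=> z Cz; apply/esym/Cz.
have SS y z : S y -> S z -> commute y z.
  by move=> Sy Sz; apply: Sy => k g; apply: Sz => l h; apply: defect_commute.
have S1 : S 1 by move=> z _; apply/esym/commute1.
have SM y z : S y -> S z -> S (y * z).
  by move=> Sy Sz u Cu; apply/esym/commuteM; apply/esym; [apply: Sy|apply: Sz].
have SV y : S y -> S y^-1 by move=> Sy u Cu; apply/esym/commuteV/esym/Sy.
have [K [iK [iK_inj iKP]]] := subgroup_groupType S1 SM SV.
have SK y : S (iK y) by apply/iKP; exists y.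
have KC (y z : K) : commute y z.
  by apply: iK_inj; rewrite !gmulfM; apply: SS.
have [A [iA [jA iAK jAK]]] := abelian_zmodType KC.
pose i := mul_comp iK iA.
have i_inj : injective i by move=> y z /iK_inj /(can_inj iAK).
have iP y : S y <-> exists b, i b = y.
  split=> [/iKP [b <-]|[b <-]]; last exact: SK.
  by exists (jA b); rewrite /i /= jAK.
have /choice [act actE] (u : F * A) : exists b : A, i b = i u.2 ^ (s u.1)^-1.
  by apply/iP; rewrite -SJ; apply: SK.
have act1 b : act (1, b) = b.
  by apply: i_inj; rewrite actE multiplicative1 invg1 conjg1.
have actM g h b : act (g * h, b) = act (g, act (h, b)).
  by apply: i_inj; rewrite !actE gmulfM invgM conjgM.
have actD g b b' : (act (g, b + b') = act (g, b) + act (g, b'))%R.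
  by apply: i_inj; rewrite to_multiplicativeD !actE to_multiplicativeD conjMg.
exists A, i, (ZAction act1 actM actD); split=> [g y|k g]; first exact: actE.
exact/iP.
Qed.

End AbelianKernel.

(** * The two isomorphisms *)

Section Pol2.
Local Open Scope group_scope.

Lemma sdprodM (H : groupType) (N : zmodType) (a : zaction H N)
    (y z : sdprod a) :
  y * z = ((y.1 + a y.2 z.1)%R, y.2 * z.2).
Proof. by []. Qed.

Lemma sdprodV (H : groupType) (N : zmodType) (a : zaction H N) (y : sdprod a) :
  y^-1 = ((- a (y.2^-1)%g y.1)%R, y.2^-1).
Proof. by []. Qed.

Lemma pair_index (d : nat) :
  exists (q : 'I_d * 'I_d -> 'I_(d ^ 2)%N) (q' : 'I_(d ^ 2)%N -> 'I_d * 'I_d),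
    cancel q q' /\ cancel q' q.
Proof.
rewrite -mulnn; have [q' qK q'K] := curry_mxvec_bij d d.
by exists (uncurry (@mxvec_index d d)), q'; split=> j; [apply: qK | apply: q'K].
Qed.

Lemma Pol2_sdprod (d : nat) (F P : groupType) (x : 'I_d -> F) (phi : F -> P) :
  is_free_group x -> is_Pol2 phi ->
  isomorphic P (sdprod (lmul_action F (d ^ 2)%N)).
Proof.
move=> freeF PolP; have [phi1 phi2 phiU] := PolP.
have [q [q' [qK q'K]]] := pair_index d.
set T := sdprod _.
have [psi [psi1 psi2 psix psid]] := sdprod_quadratic
  (lmul_action F (d ^ 2)%N) (fun i j => monomial_vec (q (i, j)) 1) freeF.
have [h [hphi _]] := phiU T psi psi1 psi2.
have hd k g : h (defect phi k g) = defect psi k g.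
  by rewrite -defect_comp (funext hphi).
have [s [sx _]] := freeF P (phi \o x).
have [A [i [a [ai iP]]]] := defect_module freeF phi1 phi2 sx.
have /choice [w wE] j : exists y, i y = defect phi (x (q' j).1) (x (q' j).2).
  exact: iP.
have [t [ta tw]] := monomial_vec_universal a w.
(* [t] is equivariant and [i] turns the action into conjugation by [s], which is the semidirect
   product law. *)
have fM : {morph (fun y : T => i (t y.1) * s y.2) : y z / y * z}.
  move=> [v f] [u g] /=; rewrite raddfD to_multiplicativeD ta ai gmulfM.
  by rewrite conjgE invgK !mulgA mulgVK.
pose f := mul_pack fM.
have fh : mul_comp f h =1 (idfun : {multiplicative P -> P}).
  apply: (Pol2_hom_ext freeF PolP) => [j|j k] /=.
    by rewrite [h _]hphi psix /= raddf0 [i _](multiplicative1 i) mul1g [s _]sx.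
  by rewrite hd psid /= tw wE qK /= multiplicative1 mulg1.
have inM : {morph (fun g => (0%R, g) : T) : g k / g * k}.
  by move=> g k; rewrite sdprodM zact0 addr0.
have hs : mul_comp h s =1 mul_pack inM.
  by apply: (free_group_ext freeF) => j /=; rewrite [s _]sx [h _]hphi psix.
(* On a monomial, [i (t _)] is the conjugate by [s g] of a defect, and [h] sends it to the conjugate
   of a basis vector by [(0, g)], which is its translate by [g]. *)
have ht : forall v, h (i (t v)) = (v, 1).
  apply: monomial_vec_ind => [|v u Ev Eu|v Ev|j g].
  - by rewrite raddf0 [i _](multiplicative1 i) multiplicative1.
  - by rewrite raddfD to_multiplicativeD gmulfM Ev Eu sdprodM zact1 mulg1.
  - rewrite raddfN [i _](multiplicativeV i) multiplicativeV Ev.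
    by rewrite sdprodV invg1 zact1.
  - rewrite -[g]mulg1 -lmul_pow_monomial ta ai tw wE conjgE invgK 2!gmulfM.
    rewrite multiplicativeV hd psid -surjective_pairing q'K [h (s g)]hs.
    by rewrite !sdprodM sdprodV !zact0 oppr0 zact0 addr0 add0r mul1g mulgV.
exists h, f => [p|[v g]]; first exact: fh.
rewrite gmulfM /= ht [h _]hs.
by rewrite sdprodM zact0 addr0 mul1g.
Qed.

Lemma abelianization_universal (G : groupType) (A : zmodType)
    (h : {multiplicative G -> Algebra.to_multiplicative A}) :
  exists f : {additive abelianization G -> A}, forall p, f (ab_pi p) = h p.
Proof.
have hC (y z : Algebra.to_multiplicative A) : commute y z by apply: addrC.
have h0 y : derived y -> h y = 1.
  elim=> [u v||u v _ Eu _ Ev|u _ Eu].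
  - rewrite !(gmulfM, multiplicativeV).
    by rewrite mulgA -invgM (hC (h v)) mulVg.
  - exact: multiplicative1.
  - by rewrite gmulfM Eu Ev mulg1.
  - by rewrite multiplicativeV Eu invg1.
pose f (y : abelianization G) : A := h (repr y).
have fE p : f (ab_pi p) = h p.
  rewrite /f; apply: (@divg1_eq _ (h _)); rewrite -multiplicativeV -gmulfM.
  exact/h0/derived_repr.
have fD : {morph f : y z / (y + z)%R}.
  move=> y z; have [p <-] := ab_pi_surj y; have [r <-] := ab_pi_surj z.
  by rewrite -ab_piM !fE gmulfM.
by exists (add_pack fD).
Qed.

Lemma Pol2_abelianization (d : nat) (F P : groupType) (x : 'I_d -> F)
    (phi : F -> P) :
  is_free_group x -> is_Pol2 phi ->
  zmod_isomorphic (abelianization P) {ffun 'I_(d ^ 2 + d)%N -> int}.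
Proof.
move=> freeF PolP; have [phi1 phi2 phiU] := PolP.
have [q [q' [qK q'K]]] := pair_index d.
pose M : zmodType := {ffun 'I_(d ^ 2)%N -> int}.
pose triv := @ZAction F M (fun _ y => y) (fun=> erefl) (fun _ _ _ => erefl)
  (fun _ _ _ => erefl).
have [n [e [c [nM cM eM nex cx]]]] :=
  free_quadratic triv (fun i j => unit_vec (q (i, j))) freeF.
pose E : zmodType := (M * {ffun 'I_d -> int})%type.
pose Em : groupType := Algebra.to_multiplicative E.
have CM k : {morph (fun g => (c k g, 0%R) : Em) : g h / g * h}.
  by move=> g h; rewrite cM; congr (_, _); rewrite addr0.
(* With the trivial action, g |-> [(n g, e g)] is quadratic into the abelian group [E], with defect
   [(c k g, 0)]. *)
have psiM k g : (n (k * g), e (k * g)) =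
    ((c k g, 0%R) : Em) * (n k, e k) * (n g, e g).
  by rewrite nM eM -{1}[e k]add0r.
have [psi1 psi2 psid] := quadraticP CM psiM.
have [h [hphi _]] := phiU Em _ psi1 psi2.
have hd k g : h (defect phi k g) = (c k g, 0%R).
  by rewrite -psid -defect_comp (funext hphi).
have [al alE] := abelianization_universal h.
(* The candidate inverse of [al] sends the two families of unit vectors to the classes of the
   defects and of the [phi (x j)]. *)
pose be (y : E) : abelianization P :=
  (\sum_j ab_pi (defect phi (x (q' j).1) (x (q' j).2)) *~ y.1 j
   + \sum_j ab_pi (phi (x j)) *~ y.2 j)%R.
have beD : {morph be : y z / (y + z)%R}.
  move=> y z; rewrite /be addrACA -!big_split.
  by congr (_ + _)%R; apply: eq_bigr => j _; rewrite ffunE mulrzDr.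
have albe y : al (be y) = y.
  pose i1 (v : M) : E := (v, 0%R); pose i2 v : E := (0%R, v).
  have i1D : {morph i1 : u v / (u + v)%R}.
    by move=> u v; congr (_, _); rewrite addr0.
  have i2D : {morph i2 : u v / (u + v)%R}.
    by move=> u v; congr (_, _); rewrite addr0.
  rewrite raddfD; transitivity (i1 y.1 + i2 y.2)%R; last first.
    by case: y => u v; congr (_, _); rewrite ?addr0 ?add0r.
  congr (_ + _)%R; rewrite raddf_sum.
    rewrite -[in RHS](sum_unit_vec y.1) [RHS](raddf_sum (add_pack i1D)).
    apply: eq_bigr => j _; rewrite raddfMz [RHS](raddfMz (add_pack i1D)) /=.
    by rewrite alE hd cx -surjective_pairing q'K.
  rewrite -[in RHS](sum_unit_vec y.2) [RHS](raddf_sum (add_pack i2D)).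
  apply: eq_bigr => j _; rewrite raddfMz [RHS](raddfMz (add_pack i2D)) /=.
  by rewrite alE [h _]hphi (nex j).1 (nex j).2.
pose AbP : groupType := Algebra.to_multiplicative (abelianization P).
have pM : {morph (@ab_pi P : P -> AbP) : y z / y * z} by apply: ab_piM.
have beM : {morph (be : Em -> AbP) : y z / y * z} by apply: beD.
(* Composed with [ab_pi], both sides are homomorphisms out of [P], so [Pol2_hom_ext] reduces the
   claim to generators. *)
have beal p : be (al p) = p.
  have [y <-] := ab_pi_surj p; rewrite alE; move: y.
  pose f1 := mul_comp (mul_pack beM) h; pose f2 := mul_pack pM.
  apply: (Pol2_hom_ext (f := f1) (g := f2) freeF PolP).
    move=> j; rewrite /= [h _]hphi (nex j).1 (nex j).2 /be /=.
    rewrite big1 => [|k _]; last by rewrite ffunE mulr0z.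
    by rewrite add0r sum_coef_unit_vec.
  move=> j k; rewrite /= hd cx /be /= sum_coef_unit_vec qK.
  by rewrite big1 ?addr0 // => l _; rewrite ffunE mulr0z.
pose ga (y : E) : {ffun 'I_(d ^ 2 + d)%N -> int} :=
  [ffun k => match split k with inl j => y.1 j | inr j => y.2 j end].
pose ga' (v : {ffun 'I_(d ^ 2 + d)%N -> int}) : E :=
  ([ffun j => v (lshift d j)], [ffun j => v (rshift (d ^ 2)%N j)]).
have gaD : {morph ga : y z / (y + z)%R}.
  move=> y z; apply/ffunP=> k; rewrite !ffunE.
  by case: split => j; rewrite ffunE.
have gaK : cancel ga ga'.
  move=> [v z]; congr (_, _); apply/ffunP=> j; rewrite !ffunE.
    by rewrite (unsplitK (inl _ j)).
  by rewrite (unsplitK (inr _ j)).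
have ga'K : cancel ga' ga.
  move=> v; apply/ffunP=> k; rewrite ffunE -[in RHS](splitK k).
  by case: split => j; rewrite ffunE.
have galD : {morph ga \o al : y z / (y + z)%R}.
  by move=> y z; rewrite /= raddfD gaD.
by exists (add_pack galD), (be \o ga') => y /=; rewrite ?gaK ?beal // albe ga'K.
Qed.

End Pol2.

Theorem corollary4p1 (d : nat) (F : groupType) (x : 'I_d -> F)
    (P : groupType) (phi : F -> P) :
  is_free_group x -> is_Pol2 phi ->
  isomorphic P (sdprod (lmul_action F (d ^ 2))) /\
  zmod_isomorphic (abelianization P) {ffun 'I_(d ^ 2 + d) -> int}.
Proof.
move=> freeF PolP.
by split; [apply: Pol2_sdprod PolP | apply: Pol2_abelianization PolP].
Qed.
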